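(* Let $X \subseteq \mathbb{Z}^d$ be finite, non-empty and lattice-convex, let $Y \subseteq \mathbb{Z}^d \setminus X$ be finite and non-empty, let $\varepsilon > 0$ be such that $\mathrm{rc}_\varepsilon(X,Y)$ exists, and suppose that both the compact model and the cutting plane model for $(X,Y,\varepsilon)$ with $k$ inequalities are feasible. Let $v^\star_{\mathrm{com}}$ and $v^\star_{\mathrm{cut}}$ denote the optimal values of the LP relaxations of the compact model and of the cutting plane model, respectively. Then: \begin{enumerate} \item $v^\star_{\mathrm{com}} \geq v^\star_{\mathrm{cut}} = 1$. \item Moreover, if $\varepsilon \leq (d-1)(\rho_X + \rho_Y)$, then $v^\star_{\mathrm{com}} = 1$. \end{enumerate}
   Context: $d$ and $k$ are positive integers and $[n]=\{1,\dots,n\}$. A set $X\subseteq\mathbb{Z}^d$ is lattice-convex if $X=\mathrm{conv}(X)\cap\mathbb{Z}^d$. Put $\rho_X=\max\{\|x\|_\infty : x\in X\}$ and $\rho_Y=\max\{\|y\|_\infty : y\in Y\}$. A set $C\subseteq Y$ and $X$ are linearly $\varepsilon$-separable if there are $a\in\mathbb{R}^d$ with $\|a\|_\infty=1$ and $\beta\in\mathbb{R}$ such that $a^\top x\le\beta$ for all $x\in X$ and $a^\top y\ge\beta+\varepsilon$ for all $y\in C$. $\mathrm{rc}_\varepsilon(X,Y)$ is the smallest number of inequalities $a^\top x\le\beta$ with $\|a\|_\infty=1$, all valid for $X$, such that every $y\in Y$ satisfies $a^\top y\ge\beta+\varepsilon$ for at least one of them; it ''exists'' if such a finite family of inequalities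 exists. Both models are considered for the same $k$, an upper bound on the number of inequalities. Compact model: with a constant $M\ge d(\rho_X+\rho_Y)+\varepsilon$, minimize $\sum_{i=1}^k u_i$ over variables $a_{ij},b_i\in\mathbb{R}$, $s_{yi},u_i$ ($y\in Y$, $i\in[k]$, $j\in[d]$) subject to $\sum_{j=1}^d a_{ij}x_j\le b_i$ for $x\in X$, $i\in[k]$; $\sum_{i=1}^k s_{yi}\ge1$ for $y\in Y$; $\sum_{j=1}^d a_{ij}y_j\ge b_i+\varepsilon-M(1-s_{yi})$ for $y\in Y$, $i\in[k]$; $s_{yi}\le u_i$ for $y\in Y$, $i\in[k]$; $-1\le a_{ij}\le1$ for $(i,j)\in[k]\times[d]$; $-d\rho_X\le b_i\le d\rho_X$ for $i\in[k]$; $s_{yi},u_i\in\{0,1\}$ for $y\in Y$, $i\in[k]$. Cutting plane model: let $\mathcal{C}=\{C\subseteq Y : C \text{ and } X \text{ are not linearly } \varepsilon\text{-separable}\}$. Minimize $\sum_{i=1}^k u_i$ over $s_{yi},u_i$ subject to $\sum_{i=1}^k s_{yi}\ge1$ for $y\in Y$; $\sum_{y\in C}s_{yi}\le|C|-1$ for $C\in\mathcal{C}$, $i\in[k]$; $s_{yi}\le u_i$ for $y\in Y$, $i\in[k]$; $s_{yi},u_i\in\{0,1\}$ for $y\in Y$, $i\in[k]$. The LP relaxation of either model is obtained by replacing $s_{yi},u_i\in\{0,1\}$ by $0\le s_{yi},u_i\le1$. *)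

(* Defs.v *)
From mathcomp Require Export all_boot all_order all_algebra finmap.
From mathcomp Require Export all_classical all_reals all_analysis.
Export Order.TTheory GRing.Theory Num.Theory numFieldNormedType.Exports.

Set Implicit Arguments.
Unset Strict Implicit.
Unset Printing Implicit Defensive.

Local Open Scope classical_set_scope.
Local Open Scope ring_scope.

Definition real_vec (R : realType) (d : nat) (x : 'rV[int]_d) : 'rV[R]_d :=
  map_mx intr x.

(* `smallest C G` is the intersection of all supersets of G satisfying C. *)
Definition convex_hull (R : realType) (d : nat) (A : set 'rV[R]_d)
    : set 'rV[R]_d :=
  smallest (@convex_set R 'rV[R]_d) A.

Definition lattice_convex (R : realType) (d : nat) (X : {fset 'rV[int]_d})
    : Prop :=
  [set` X] = @real_vec R d @^-1` convex_hull (@real_vec R d @` [set` X]).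

(* The norm of 'rV[R]_d is the maximum norm. *)
Definition rho (R : realType) (d : nat) (X : {fset 'rV[int]_d}) : R :=
  \big[Num.max/0]_(x <- X) `|real_vec R x|.

Definition dot (R : realType) (d : nat) (a : 'rV[R]_d) (x : 'rV[int]_d) : R :=
  \sum_(j < d) a 0 j * (x 0 j)%:~R.

Definition eps_separable (R : realType) (d : nat) (eps : R)
    (X C : {fset 'rV[int]_d}) : Prop :=
  exists (a : 'rV[R]_d) (beta : R),
    [/\ `|a| = 1,
        forall x, x \in X -> dot a x <= beta
      & forall y, y \in C -> dot a y >= beta + eps].

(* rc_eps(X, Y) is the least m for which such a family of m inequalities
   exists; only its existence is needed. *)
Definition eps_separating_family (R : realType) (d m : nat) (eps : R)
    (X Y : {fset 'rV[int]_d}) (a : 'I_m -> 'rV[R]_d) (b : 'I_m -> R) : Prop :=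
  [/\ forall i, `|a i| = 1,
      forall i x, x \in X -> dot (a i) x <= b i
    & forall y, y \in Y -> exists i, dot (a i) y >= b i + eps].

Definition rc_exists (R : realType) (d : nat) (eps : R)
    (X Y : {fset 'rV[int]_d}) : Prop :=
  exists (m : nat) (a : 'I_m -> 'rV[R]_d) (b : 'I_m -> R),
    eps_separating_family eps X Y a b.

(* In both models D is the domain of the variables s and u: {0, 1} for the
   integer program and [0, 1] for its LP relaxation. The variable s_{yi} is
   `s y i`; the values of s outside Y occur in no constraint. *)
Definition binary (R : realType) : set R := [set 0; 1].
Definition relaxed (R : realType) : set R := [set t | 0 <= t <= 1].

Section Models.
Variables (R : realType) (d k : nat) (eps : R) (X Y : {fset 'rV[int]_d}).

Record compact_constraints (M : R) (D : set R)
    (a : 'M[R]_(k, d)) (b : 'I_k -> R)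
    (s : 'rV[int]_d -> 'I_k -> R) (u : 'I_k -> R) : Prop := {
  com_valid : forall x i, x \in X -> dot (row i a) x <= b i;
  com_cover : forall y, y \in Y -> \sum_(i < k) s y i >= 1;
  com_separate : forall y i, y \in Y ->
    dot (row i a) y >= b i + eps - M * (1 - s y i);
  com_select : forall y i, y \in Y -> s y i <= u i;
  com_bound_a : forall i j, -1 <= a i j <= 1;
  com_bound_b : forall i, - (d%:R * rho R X) <= b i <= d%:R * rho R X;
  com_dom_s : forall y i, y \in Y -> D (s y i);
  com_dom_u : forall i, D (u i)
}.

Record cutting_constraints (D : set R)
    (s : 'rV[int]_d -> 'I_k -> R) (u : 'I_k -> R) : Prop := {
  cut_cover : forall y, y \in Y -> \sum_(i < k) s y i >= 1;
  cut_conflict : forall (C : {fset 'rV[int]_d}) i,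
    (C `<=` Y)%fset -> ~ eps_separable eps X C ->
    \sum_(y <- C) s y i <= (#|` C|)%:R - 1;
  cut_select : forall y i, y \in Y -> s y i <= u i;
  cut_dom_s : forall y i, y \in Y -> D (s y i);
  cut_dom_u : forall i, D (u i)
}.

Definition compact_values (M : R) (D : set R) : set R :=
  [set v | exists a b s u,
     compact_constraints M D a b s u /\ v = \sum_(i < k) u i].

Definition cutting_values (D : set R) : set R :=
  [set v | exists s u, cutting_constraints D s u /\ v = \sum_(i < k) u i].

Definition compact_feasible (M : R) : Prop :=
  compact_values M (@binary R) !=set0.

Definition cutting_feasible : Prop := cutting_values (@binary R) !=set0.

(* The optimal value of a minimization problem is the infimum, in the extended
   reals, of its objective values (+oo when infeasible). *)
Definition compact_lp_value (M : R) : \bar R :=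
  ereal_inf (EFin @` compact_values M (@relaxed R)).

Definition cutting_lp_value : \bar R :=
  ereal_inf (EFin @` cutting_values (@relaxed R)).

End Models.

(* Main.v *)
Require Import Defs.
From mathcomp Require Import lra.

(** Since [s y i <= u i], summing the covering constraint of a single [y] shows
    that both relaxations have value at least [1].  For [k >= 2] the uniform
    point [s = u = 1 / k] attains [1]: in the cutting plane model every
    conflict set has at least two elements because rc_eps exists, and in the
    compact model [a = 0], [b = 0] works because [M >= 2 * eps].  For [k = 1]
    the covering constraint forces integer solutions to have [s = u = 1]. *)

Local Open Scope ring_scope.

Lemma ereal_inf_EFin_min (R : realType) (A : set R) (v : R) :
  A v -> lbound A v -> ereal_inf (EFin @` A) = v%:E.
Proof.
move=> Av lbv; apply/eqP; rewrite eq_le; apply/andP; split.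
  by apply: ereal_inf_lbound; exists v.
by apply: le_ereal_inf_tmp => _ [w Aw <-]; rewrite lee_fin; exact: lbv.
Qed.

Lemma rho_ge0 (R : realType) (d : nat) (X : {fset 'rV[int]_d}) : 0 <= rho R X.
Proof.
rewrite /rho; elim/big_rec: _ => // x v _ v_ge0.
by rewrite le_max v_ge0 orbT.
Qed.

Lemma sum_inv_card (R : realType) (k : nat) :
  (0 < k)%N -> \sum_(i < k) (k%:R^-1 : R) = 1.
Proof.
move=> k_gt0; rewrite sumr_const card_ord -[LHS]mulr_natl divff //.
by rewrite pnatr_eq0 -lt0n.
Qed.

Lemma inv_nat_relaxed (R : realType) (k : nat) :
  (0 < k)%N -> @relaxed R k%:R^-1.
Proof.
by move=> k_gt0; rewrite /relaxed /= invr_ge0 ler0n invf_le1 ?ltr0n ?ler1n.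
Qed.

Lemma inv_nat_le_half (R : realType) (k : nat) :
  (1 < k)%N -> k%:R^-1 <= 2^-1 :> R.
Proof.
by move=> k_gt1; rewrite lef_pV2 ?posrE ?ltr0n ?(ltnW k_gt1) ?ler_nat.
Qed.

Lemma binary_relaxed (R : realType) : (@binary R `<=` @relaxed R)%classic.
Proof. by move=> t [->|->]; rewrite /relaxed /= lexx ler01. Qed.

(** Kept free of either model: it serves both relaxations and, when [k = 1], the integer solution of
    the compact model. *)
Lemma cover_select_ge1 {R : realType} {d k : nat} {Y : {fset 'rV[int]_d}}
    {s : 'rV[int]_d -> 'I_k -> R} {u : 'I_k -> R} :
  Y != fset0 -> (forall y, y \in Y -> 1 <= \sum_(i < k) s y i) ->
  (forall y i, y \in Y -> s y i <= u i) -> 1 <= \sum_(i < k) u i.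
Proof.
move=> /fset0Pn[y yY] cover select; apply: le_trans (cover _ yY) _.
by apply: ler_sum => i _; exact: select.
Qed.

Lemma compact_values_ge1 {R : realType} {d k : nat} {eps M : R}
    {X Y : {fset 'rV[int]_d}} {D : set R} :
  Y != fset0 -> lbound (compact_values k eps X Y M D) 1.
Proof.
by move=> Y0 _ [a [b [s [u [[_ cov _ sel _ _ _ _] ->]]]]];
  exact: cover_select_ge1 Y0 cov sel.
Qed.

Lemma cutting_values_ge1 {R : realType} {d k : nat} {eps : R}
    {X Y : {fset 'rV[int]_d}} {D : set R} :
  Y != fset0 -> lbound (cutting_values k eps X Y D) 1.
Proof.
by move=> Y0 _ [s [u [[cov _ sel _ _] ->]]]; exact: cover_select_ge1 Y0 cov sel.
Qed.

(** Each single [y] is cut off by some inequality of the separating family, and that inequality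
    alone witnesses separability of every subset of [[fset y]]. *)
Lemma conflict_card_gt1 {R : realType} {d : nat} {eps : R}
    {X Y C : {fset 'rV[int]_d}} :
  Y != fset0 -> rc_exists eps X Y -> (C `<=` Y)%fset ->
  ~ eps_separable eps X C -> (1 < #|` C|)%N.
Proof.
move=> /fset0Pn[y0 y0Y] [m [a [b [norm1 valid sep]]]] CY; apply: contra_notT.
rewrite -leqNgt => C_le1.
have [y yY Cy] : exists2 y, y \in Y & (C `<=` [fset y])%fset.
  (* For empty [C] any point of [Y] will do; it only selects an inequality of the family, which
     supplies a normalized [a] valid on [X]. *)
  have [->|/fset0Pn[y yC]] := eqVneq C fset0; first by exists y0.
  exists y; first exact: (fsubsetP CY).
  suff -> : C = [fset y]%fset by [].
  by apply/esym/eqP; rewrite eqEfcard fsub1set yC cardfs1.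
have [i sepi] := sep y yY.
exists (a i), (b i); split=> // [x|z /(fsubsetP Cy)]; first exact: valid.
by rewrite inE => /eqP ->.
Qed.

Lemma cutting_values_1 (R : realType) (d k : nat) (eps : R)
    (X Y : {fset 'rV[int]_d}) :
  (0 < k)%N -> Y != fset0 -> rc_exists eps X Y -> cutting_feasible k eps X Y ->
  cutting_values k eps X Y (@relaxed R) 1.
Proof.
move=> k_gt0 Y0 rcX [_ [s [u [[cover conflict _ _ _] _]]]].
exists (fun _ _ => k%:R^-1), (fun=> k%:R^-1); rewrite sum_inv_card //.
split=> //; split=> //; try by move=> *; exact: inv_nat_relaxed.
  by move=> y yY; rewrite sum_inv_card.
move=> C i CY Cconf; rewrite big_const_seq count_predT iter_addr_0 -[leLHS]mulr_natl.
have [k_gt1|k_le1] := ltnP 1 k.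
  have C_gt1 : 2 <= #|` C|%:R :> R.
    by rewrite ler_nat (conflict_card_gt1 Y0 rcX CY).
  (* The left side is at most [#|C| / 2], and this is at most [#|C| - 1] once [#|C| >= 2]. *)
  have := inv_nat_le_half R _ k_gt1; nra.
have k1 : k = 1%N by apply/eqP; rewrite eqn_leq k_le1.
subst k; have := conflict C i CY Cconf.
(* With one inequality, covering forces [s y i >= 1] on all of [C], which contradicts the conflict
   constraint of the feasible integer point: no conflict set exists. *)
suff : #|` C|%:R <= \sum_(y <- C) s y i by lra.
rewrite -sum1_size natr_sum big_seq [leRHS]big_seq.
apply: ler_sum => y yC; apply: le_trans (cover y (fsubsetP CY y yC)) _.
by rewrite big_ord1 (ord1 i).
Qed.

Lemma compact_values_1 (R : realType) (d k : nat) (eps M : R)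
    (X Y : {fset 'rV[int]_d}) :
  (0 < k)%N -> Y != fset0 -> 0 <= M -> 2 * eps <= M ->
  compact_feasible k eps X Y M -> compact_values k eps X Y M (@relaxed R) 1.
Proof.
move=> k_gt0 Y0 M_ge0 M_ge feas.
have [k_gt1|k_le1] := ltnP 1 k.
  have dot0 x i : dot (row i (0 : 'M[R]_(k, d))) x = 0.
    by rewrite /dot big1 // => j _; rewrite !mxE mul0r.
  exists 0, (fun=> 0), (fun _ _ => k%:R^-1), (fun=> k%:R^-1).
  rewrite sum_inv_card //; split=> //.
  split=> //; try by move=> *; exact: inv_nat_relaxed.
  - by move=> x i _; rewrite dot0.
  - by move=> y yY; rewrite sum_inv_card.
  (* The constraint reads [0 >= eps - M * (1 - 1 / k)]; here [1 - 1 / k >= 1 / 2] and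
     [M / 2 >= eps]. *)
  - by move=> y i _; rewrite dot0; have := inv_nat_le_half R _ k_gt1; nra.
  - by move=> i j; rewrite mxE lerN10 ler01.
  - by move=> i; rewrite oppr_le0 mulr_ge0 ?rho_ge0.
have k1 : k = 1%N by apply/eqP; rewrite eqn_leq k_le1.
subst k; have [_ [a [b [s [u [cs _]]]]]] := feas.
(* The integer solution itself is the relaxed point: its only [u] is binary and at least 1, so the
   objective is 1. *)
exists a, b, s, u; split.
  case: cs => *; split=> // *; apply: binary_relaxed; auto.
have := cover_select_ge1 Y0 (com_cover cs) (com_select cs).
by rewrite big_ord1; case: (com_dom_u cs ord0) => -> //; rewrite ler10.
Qed.

Theorem proposition3p1 (R : realType) (d k : nat) (X Y : {fset 'rV[int]_d})
    (eps M : R) :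
  (0 < d)%N -> (0 < k)%N ->
  X != fset0 -> lattice_convex R X ->
  Y != fset0 -> [disjoint Y & X]%fset ->
  0 < eps -> rc_exists eps X Y ->
  d%:R * (rho R X + rho R Y) + eps <= M ->
  compact_feasible k eps X Y M -> cutting_feasible k eps X Y ->
  ((cutting_lp_value k eps X Y <= compact_lp_value k eps X Y M)%E /\
   cutting_lp_value k eps X Y = 1%E) /\
  (eps <= (d%:R - 1) * (rho R X + rho R Y) ->
   compact_lp_value k eps X Y M = 1%E).
Proof.
move=> d_gt0 k_gt0 _ _ Y0 _ eps_gt0 rcX M_ge com_feas cut_feas.
have cut1 : cutting_lp_value k eps X Y = 1%E.
  apply: ereal_inf_EFin_min; first exact: cutting_values_1.
  exact: cutting_values_ge1.
split; [split=> //|move=> eps_le].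
  rewrite cut1; apply: le_ereal_inf_tmp => _ [v v_com <-].
  by rewrite lee_fin; exact: compact_values_ge1 Y0 _ v_com.
have rho_sum_ge0 : 0 <= rho R X + rho R Y by rewrite addr_ge0 ?rho_ge0.
apply: ereal_inf_EFin_min; last exact: compact_values_ge1.
(* With [S = rho R X + rho R Y], the bound on [eps] gives [d * S = (d - 1) * S + S >= eps + S],
   hence [M >= 2 * eps + S >= 2 * eps]. *)
by apply: compact_values_1 => //; nra.
Qed.
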